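(* Let $d\ge 3$. Then with probability $1$, for any $\varepsilon>0$ there is a random variable $n_0$ such that $$\xi(n)\ge\lambda\log n-(2+\varepsilon)\log\log n$$ if $n\ge n_0$.
   Context: $\{\mathbf S_n\}_{n\ge 0}$ is the simple symmetric random walk on the $d$-dimensional integer lattice $\mathcal Z_d$, started at $\mathbf S_0=\mathbf 0$ (each step is $\pm\mathbf e_i$ with probability $\frac1{2d}$, $i=1,\dots,d$). The local time is $\xi(\mathbf x,n)=\#\{k:0<k\le n,\ \mathbf S_k=\mathbf x\}$, and the maximal local time is $\xi(n)=\max_{\mathbf x\in\mathcal Z_d}\xi(\mathbf x,n)$. $\gamma>0$ is the probability that the walk never returns to its starting point, and $\lambda=\lambda_d=-1/\log(1-\gamma)$. *)

(* Defs.v *)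
From HB Require Import structures.
From mathcomp Require Import all_boot all_order all_algebra finmap.
From mathcomp Require Import all_classical all_reals all_analysis.

Set Implicit Arguments.
Unset Strict Implicit.
Unset Printing Implicit Defensive.

Import Order.TTheory GRing.Theory Num.Theory.

Local Open Scope classical_set_scope.
Local Open Scope ring_scope.

(* The lattice Z^d is 'rV[int]_d, regarded as a discrete space: every subset
   of it is an event. *)
Definition basis_vec (d : nat) (i : 'I_d) : 'rV[int]_d := delta_mx 0 i.

Definition walk_step (T : Type) (d : nat) (S : nat -> T -> 'rV[int]_d)
    (k : nat) : T -> 'rV[int]_d :=
  fun w => S k.+1 w - S k w.

Definition mutually_independent (disp : measure_display)
    (T : measurableType disp) (R : realType) (P : probability T R)
    (V : Type) (X : nat -> T -> V) : Prop :=
  forall (J : {fset nat}) (A : nat -> set V),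
    P (\bigcap_(j in [set` J]) (X j @^-1` A j)) =
    (\prod_(j <- J) P (X j @^-1` A j))%E.

Definition simple_random_walk (disp : measure_display)
    (T : measurableType disp) (R : realType) (P : probability T R)
    (d : nat) (S : nat -> T -> 'rV[int]_d) : Prop :=
  [/\ forall w, S 0%N w = 0,
      forall (n : nat) (A : set 'rV[int]_d), measurable (S n @^-1` A),
      forall (k : nat) (i : 'I_d),
        P (walk_step S k @^-1` [set basis_vec i]) = ((2 * d%:R)^-1)%:E /\
        P (walk_step S k @^-1` [set - basis_vec i]) = ((2 * d%:R)^-1)%:E
    & mutually_independent P (walk_step S)].

(* The visit at time 0 is not counted. *)
Definition local_time (T : Type) (d : nat) (S : nat -> T -> 'rV[int]_d)
    (x : 'rV[int]_d) (n : nat) (w : T) : nat :=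
  (\sum_(1 <= k < n.+1) (S k w == x))%N.

(* The supremum over all of Z^d is attained, see max_local_time_max. *)
Definition max_local_time (R : realType) (T : Type) (d : nat)
    (S : nat -> T -> 'rV[int]_d) (n : nat) (w : T) : R :=
  sup (range (fun x => (local_time S x n w)%:R : R)).

Lemma local_time_le (T : Type) (d : nat) (S : nat -> T -> 'rV[int]_d)
    (x : 'rV[int]_d) (n : nat) (w : T) : (local_time S x n w <= n)%N.
Proof.
rewrite /local_time; apply: (@leq_trans (\sum_(1 <= k < n.+1) 1)).
  by apply: leq_sum => k _; case: (_ == _).
by rewrite sum_nat_const_nat muln1 subn1.
Qed.

Lemma max_local_time_max (R : realType) (T : Type) (d : nat)
    (S : nat -> T -> 'rV[int]_d) (n : nat) (w : T) :
  (exists x, max_local_time R S n w = (local_time S x n w)%:R) /\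
  (forall x, (local_time S x n w)%:R <= max_local_time R S n w).
Proof.
pose Q m := `[< exists x, local_time S x n w = m >].
have exQ : exists m, Q m by exists (local_time S 0 n w); apply/asboolP; exists 0.
have ubQ m : Q m -> (m <= n)%N by move=> /asboolP[x <-]; exact: local_time_le.
case: (ex_maxnP exQ ubQ) => m /asboolP[x xm] maxm.
have ubm y : (local_time S y n w)%:R <= (m%:R : R).
  by rewrite ler_nat; apply: maxm; apply/asboolP; exists y.
have supE : max_local_time R S n w = m%:R.
  apply/eqP; rewrite eq_le; apply/andP; split.
    apply: ge_sup; first by exists (local_time S 0 n w)%:R, 0.
    by move=> _ [y _ <-]; exact: ubm.
  apply: ub_le_sup; last by exists x => //; rewrite xm.
  by exists m%:R => _ [y _ <-]; exact: ubm.
by rewrite supE; split => [|//]; exists x; rewrite xm.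
Qed.

Definition escape_prob (disp : measure_display) (T : measurableType disp)
    (R : realType) (P : probability T R) (d : nat)
    (S : nat -> T -> 'rV[int]_d) : R :=
  fine (P [set w | forall k : nat, (0 < k)%N -> S k w <> S 0%N w]).

Definition walk_lambda (disp : measure_display) (T : measurableType disp)
    (R : realType) (P : probability T R) (d : nat)
    (S : nat -> T -> 'rV[int]_d) : R :=
  - 1 / ln (1 - escape_prob P S).

(* Main.v *)
(* Let q = 1 - gamma and let q_m be the probability of a return within m steps.
   Run trials: from the current site, ask for k successive returns, the i-th
   one within m_i steps; at the first missed deadline start afresh from the
   site then occupied.  With m_i of order i^4, uniformly in k, the success
   probability prod_(i < k) q_(m_i) is at least q^k / 2 and the expected
   duration sum_i q^i (m_0 + ... + m_i) of a trial is bounded: the former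
   because q - q_m = O(m^(-1/2)), which follows from
   P(S_n = 0) = O(n^(-3/2)) for d >= 3.  Hence the probability that no site has
   k visits by time n is at most 2 exp(- c q^k n).  Along the times
   n_k of order q^(-k) log k this is O(k^(-2)), so Borel-Cantelli gives
   xi(n_k) >= k eventually, and log n_(k+1) = k / lambda + log log k + O(1). *)
Require Import Defs.
From HB Require Import structures.
From mathcomp Require Import all_boot all_order all_algebra.
From mathcomp Require Import all_classical all_reals all_analysis.
From mathcomp Require Import finmap ring lra zify.

Import Order.TTheory GRing.Theory Num.Theory.

Local Open Scope classical_set_scope.
Local Open Scope ring_scope.

(** * Averages over words *)

Section WordAverage.
Context {R : realType} {V : finType}.
Implicit Types (phi psi : seq V -> R) (n m : nat).

(** The expectation of [phi] over [n] independent uniform letters. Unfolding the first letter makes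
    first-step analysis a computation. *)
Fixpoint wavg (n : nat) (phi : seq V -> R) : R :=
  if n is m.+1 then (#|V|%:R : R)^-1 * \sum_(s : V) wavg m (fun w => phi (s :: w))
  else phi [::].

Lemma wavg0 phi : wavg 0 phi = phi [::]. Proof. by []. Qed.

Lemma wavgS n phi :
  wavg n.+1 phi = (#|V|%:R)^-1 * \sum_(s : V) wavg n (fun w => phi (s :: w)).
Proof. by []. Qed.

Lemma wavg_le n phi psi :
  (forall w, size w = n -> phi w <= psi w) -> wavg n phi <= wavg n psi.
Proof.
elim: n phi psi => [|n IHn] phi psi H /=; first exact: H.
rewrite ler_wpM2l ?invr_ge0 ?ler0n //; apply: ler_sum => s _.
by apply: IHn => w wn; apply: H; rewrite /= wn.
Qed.

Lemma eq_wavg n phi psi :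
  (forall w, size w = n -> phi w = psi w) -> wavg n phi = wavg n psi.
Proof.
by move=> H; apply/le_anti/andP; split; apply: wavg_le => w wn; rewrite H.
Qed.

Lemma wavgD n phi psi :
  wavg n (fun w => phi w + psi w) = wavg n phi + wavg n psi.
Proof.
elim: n phi psi => [//|n IHn] phi psi /=.
by rewrite -mulrDr -big_split /=; congr *%R; apply: eq_bigr => s _; rewrite IHn.
Qed.

Lemma wavgZ n (c : R) phi : wavg n (fun w => c * phi w) = c * wavg n phi.
Proof.
elim: n phi => [//|n IHn] phi /=; rewrite [RHS]mulrCA [c * _]mulr_sumr.
by congr *%R; apply: eq_bigr => s _; rewrite IHn.
Qed.

Lemma wavg_sum n (I : finType) (phi : I -> seq V -> R) :
  wavg n (fun w => \sum_i phi i w) = \sum_i wavg n (phi i).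
Proof.
elim: n phi => [//|n IHn] phi /=; rewrite -mulr_sumr exchange_big /=.
by congr *%R; apply: eq_bigr => s _; rewrite IHn.
Qed.

Lemma wavg_cat m n phi :
  wavg (m + n) phi = wavg m (fun u => wavg n (fun v => phi (u ++ v))).
Proof.
elim: m phi => [//|m IHm] phi; rewrite addSn /=.
by congr *%R; apply: eq_bigr => s _; rewrite IHm.
Qed.

Hypothesis V0 : (0 < #|V|)%N.

Lemma wavg_const n (c : R) : wavg n (fun=> c) = c.
Proof.
elim: n => [//|n IHn] /=; rewrite IHn sumr_const -[c *+ _]mulr_natl mulrA mulVf ?mul1r//.
by rewrite pnatr_eq0 -lt0n.
Qed.

Lemma wavg_ge0 n phi : (forall w, 0 <= phi w) -> 0 <= wavg n phi.
Proof. by move=> H; rewrite -(wavg_const n 0); apply: wavg_le => w _. Qed.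

Lemma wavgB1 n phi : wavg n (fun w => 1 - phi w) = 1 - wavg n phi.
Proof.
rewrite -{2}(wavg_const n 1) -[- wavg n _]mulN1r -wavgZ -wavgD.
by apply: eq_wavg => w _; rewrite mulN1r.
Qed.

Lemma wavg_prefix_le m n (phi : seq V -> R) :
  (forall u v, phi (u ++ v) <= phi u) -> wavg (m + n) phi <= wavg m phi.
Proof.
move=> H; rewrite wavg_cat; apply: wavg_le => u _.
by rewrite -[leRHS](wavg_const n); apply: wavg_le => v _.
Qed.

End WordAverage.
Arguments wavg : simpl never.

Lemma ler_natb {R : realType} (b c : bool) : (b -> c) -> (b%:R : R) <= c%:R.
Proof. by case: b c => [] [] H; rewrite ?ler01 ?ler0n ?lexx //; have := H isT. Qed.

(** * Return trials *)

Section Visits.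
Context {R : realType} {V : finType} {G : zmodType} (step : V -> G).
Hypothesis V0 : (0 < #|V|)%N.
Implicit Types (x : G) (u v w : seq V) (k j m n : nat).

Definition pos w : G := \sum_(s <- w) step s.

(** The walk is re-rooted after each step and the target shifted instead. The starting position is
    not counted, in agreement with [local_time]. *)
Fixpoint visits x w : nat :=
  if w is s :: w' then ((step s == x) + visits (x - step s) w')%N else 0%N.

Lemma visits_cat x u v :
  visits x (u ++ v) = (visits x u + visits (x - pos u) v)%N.
Proof.
elim: u x => [|s u IHu] x /=; first by rewrite /pos big_nil subr0.
by rewrite IHu /pos big_cons opprD addrA addnA.
Qed.

Definition light k w : bool := `[< forall x, (visits x w < k)%N >].

Lemma light_catl k u v : light k (u ++ v) -> light k u.
Proof.
move=> /asboolP H; apply/asboolP => x; apply: leq_ltn_trans (H x).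
by rewrite visits_cat leq_addr.
Qed.

(** A suffix is a translated walk, and lightness concerns all sites at once, so the shift by [pos u]
    does no harm. This permits a restart after a failed trial. *)
Lemma light_catr k u v : light k (u ++ v) -> light k v.
Proof.
move=> /asboolP H; apply/asboolP => x; apply: leq_ltn_trans (H (x + pos u)).
by rewrite visits_cat addrK leq_addl.
Qed.

Definition hitp x m : R := wavg m (fun w => (0 < visits x w)%:R).
Definition retp m : R := hitp 0 m.
Definition lightp k n : R := wavg n (fun w => (light k w)%:R).
(** Here [j] is the number of visits to the current site that the running trial still lacks. *)
Definition lightj k j n : R :=
  wavg n (fun w => (light k w && (visits 0 w < j))%N%:R).

Lemma hitp_ge0 x m : 0 <= hitp x m.
Proof. by apply: wavg_ge0 => // w; rewrite ler0n. Qed.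

Lemma hitp_le1 x m : hitp x m <= 1.
Proof.
rewrite -[leRHS](wavg_const V0 m); apply: wavg_le => w _.
by rewrite lern1 leq_b1.
Qed.

Lemma retp_ge0 m : 0 <= retp m. Proof. exact: hitp_ge0. Qed.
Lemma retp_le1 m : retp m <= 1. Proof. exact: hitp_le1. Qed.

Lemma lightp_le1 k n : lightp k n <= 1.
Proof.
rewrite -[leRHS](wavg_const V0 n); apply: wavg_le => w _.
by rewrite lern1 leq_b1.
Qed.

Lemma lightj_le k j m n : lightj k j (m + n) <= lightj k j n.
Proof.
rewrite addnC; apply: wavg_prefix_le => // u v; apply: ler_natb => /andP[/light_catl -> /=].
apply: leq_ltn_trans.
by rewrite visits_cat leq_addr.
Qed.

Lemma lightp_lightj k n : lightp k n = lightj k k n.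
Proof.
apply: eq_wavg => w _; congr (_%:R); congr nat_of_bool.
by case: (boolP (light k w)) => //= /asboolP ->.
Qed.

(* After the first visit to [x] the rest of the word is a fresh walk whose
   visits to its own starting point are the later visits to [x]. *)
Lemma lightj_hit k j x m n :
  wavg m (fun u => wavg n (fun v =>
    [&& (0 < visits x u)%N, light k (u ++ v) & (visits x (u ++ v) < j.+1)%N]%:R))
  <= hitp x m * lightj k j n.
Proof.
elim: m x => [|m IHm] x.
  by rewrite /hitp !wavg0 /= mul0r wavg_const.
rewrite /hitp !wavgS /= -mulrA ler_wpM2l ?invr_ge0 ?ler0n // mulr_suml.
apply: ler_sum => s _; have [sx|sx] := boolP (step s == x); last first.
  apply: le_trans (IHm (x - step s)); apply: wavg_le => u _; apply: wavg_le => v _.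
  rewrite add0n; apply: ler_natb => /and3P[-> + ->].
  by rewrite -[s :: _]/([:: s] ++ _) => /light_catr ->.
rewrite (@wavg_const _ _ V0 _ 1) mul1r; apply: le_trans (lightj_le k j m n).
rewrite /lightj wavg_cat; apply: wavg_le => u _; apply: wavg_le => v _.
rewrite (eqP sx) subrr; apply: ler_natb => /and3P[_ + vj]; rewrite [X in _ && X]vj andbT.
by rewrite -[s :: _]/([:: s] ++ _) => /light_catr.
Qed.

(** A return within the first [m] letters leaves [j] visits to collect ([lightj_hit]); otherwise
    those letters are discarded and only the lightness of the suffix is kept. *)
Lemma lightj_step k j m n :
  lightj k j.+1 (m + n) <= retp m * lightj k j n + (1 - retp m) * lightp k n.
Proof.
apply: le_trans (lerD (lightj_hit k j 0 m n) (lexx _)).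
rewrite /retp /hitp -wavgB1 // [_ * lightp k n]mulrC -wavgZ -wavgD /lightj wavg_cat.
apply: wavg_le => u _; rewrite /lightp mulrC -wavgZ -wavgD.
apply: wavg_le => v _; case: (ltnP 0 (visits 0 u)) => _ /=.
  by rewrite subrr mul0r addr0.
by rewrite subr0 mul1r add0r; apply: ler_natb => /andP[/light_catr ->].
Qed.

Lemma expR_le1Dx2 (x : R) : 0 <= x -> x <= 2^-1 -> expR x <= 1 + 2 * x.
Proof.
move=> x0 x1; have := expR_ge1Dx (- x); rewrite expRN => h.
rewrite -[leLHS]invrK invf_ple ?posrE ?invr_gt0 ?expR_gt0 //; last by nra.
apply: le_trans h; rewrite invf_ple ?posrE; [|nra|nra].
by rewrite -[leLHS]mul1r ler_pdivrMr; nra.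
Qed.

(** * Trials with a deadline for each return *)

Section Stages.
Variable mm : nat -> nat.

(** Every stage is charged its full deadline [mm i], even if the return comes sooner, so restart
    times are deterministic. *)
Definition stage_end (l : nat) : nat := \sum_(i < l) mm i.
Definition stage_prob (l : nat) : R := \prod_(i < l) retp (mm i).

Lemma stage_endS l : stage_end l.+1 = (stage_end l + mm l)%N.
Proof. by rewrite /stage_end big_ord_recr. Qed.

Lemma stage_probS l : stage_prob l.+1 = stage_prob l * retp (mm l).
Proof. by rewrite /stage_prob big_ord_recr. Qed.

Lemma stage_prob_ge0 l : 0 <= stage_prob l.
Proof. by apply: prodr_ge0 => i _; exact: retp_ge0. Qed.

Lemma stage_end_le l l' : (l <= l')%N -> (stage_end l <= stage_end l')%N.
Proof.
move=> /subnK <-; elim: (l' - l)%N => // i IHi.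
by rewrite addSn stage_endS (leq_trans IHi) // leq_addr.
Qed.

(** Iterating [lightj_step] decomposes by the first missed deadline: the [i]-th summand is failure
    at stage [i] and a fresh start, the last term a trial still running after [l] stages. *)
Lemma lightp_stages k l n : (l <= k)%N -> (stage_end l <= n)%N ->
  lightp k n <=
    \sum_(i < l) stage_prob i * (1 - retp (mm i)) * lightp k (n - stage_end i.+1)
    + stage_prob l * lightj k (k - l) (n - stage_end l).
Proof.
elim: l => [|l IHl] lk ln.
  rewrite big_ord0 add0r /stage_end /stage_prob !big_ord0 mul1r !subn0.
  by rewrite lightp_lightj.
have ln' : (stage_end l <= n)%N.
  by apply: leq_trans ln; apply: stage_end_le.
apply: le_trans (IHl (ltnW lk) ln') _.
rewrite big_ord_recr /= -addrA lerD2l stage_probS -!mulrA -mulrDr.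
rewrite ler_wpM2l ?stage_prob_ge0 // addrC.
have -> : (n - stage_end l = mm l + (n - stage_end l.+1))%N.
  by move: ln; rewrite stage_endS; lia.
rewrite -(subnSK lk). exact: lightj_step.
Qed.

Lemma stage_fail_sum l :
  \sum_(i < l) stage_prob i * (1 - retp (mm i)) = 1 - stage_prob l.
Proof.
elim: l => [|l IHl]; first by rewrite big_ord0 /stage_prob big_ord0 subrr.
by rewrite big_ord_recr /= IHl stage_probS; ring.
Qed.

(** Strong induction on [n] with an exponential ansatz. For [l = k] the running term of
    [lightp_stages] vanishes; the factors [expR (th * stage_end i.+1)] are at most
    [1 + 2 * th * stage_end i.+1], and the excess is covered by the success probability
    [stage_prob k]. *)
Lemma lightp_decay k (th : R) : (forall i, 0 < mm i)%N -> 0 <= th ->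
  th * (stage_end k)%:R <= 2^-1 ->
  2 * th * \sum_(i < k) stage_prob i * (stage_end i.+1)%:R <= stage_prob k ->
  forall n, lightp k n <= expR (th * (stage_end k)%:R - th * n%:R).
Proof.
move=> mm0 th0 thM thS n; elim/ltn_ind: n => n IHn.
(* Below [stage_end k] the offset in the exponent makes the bound at least 1. *)
have [nM|Mn] := ltnP n (stage_end k).
  apply: le_trans (lightp_le1 _ _) _; rewrite -[leLHS]expR0 ler_expR subr_ge0.
  by apply: ler_wpM2l => //; rewrite ler_nat ltnW.
apply: le_trans (lightp_stages k k n (leqnn k) Mn) _.
rewrite subnn; have -> : lightj k 0 (n - stage_end k) = 0.
  rewrite /lightj -[RHS](wavg_const V0 (n - stage_end k)).
  by apply: eq_wavg => w _; rewrite ltn0 andbF.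
rewrite mulr0 addr0.
have key (i : 'I_k) : stage_prob i * (1 - retp (mm i)) * lightp k (n - stage_end i.+1) <=
   (stage_prob i * (1 - retp (mm i)) + 2 * th * (stage_prob i * (stage_end i.+1)%:R))
    * expR (th * (stage_end k)%:R - th * n%:R).
  have Mi : (stage_end i.+1 <= stage_end k)%N by apply: stage_end_le.
  have Mi0 : (0 < stage_end i.+1)%N by rewrite stage_endS ltn_addl.
  have := IHn (n - stage_end i.+1)%N; rewrite -subn_gt0 subKn; last exact: leq_trans Mn.
  move=> /(_ Mi0) H.
  set p := stage_prob i; set r := retp _; set e := expR _.
  set x := th * (stage_end i.+1)%:R.
  have p0 : 0 <= p by exact: stage_prob_ge0.
  have r0 : 0 <= r by exact: retp_ge0.
  have r1 : r <= 1 by exact: retp_le1.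
  have x0 : 0 <= x by rewrite mulr_ge0.
  have x1 : x <= 2^-1 by apply: le_trans thM; rewrite ler_wpM2l // ler_nat.
  have ex := expR_le1Dx2 x x0 x1.
  have H' : lightp k (n - stage_end i.+1) <= (1 + 2 * x) * e.
    apply: le_trans H _; rewrite natrB; last exact: leq_trans Mn.
    rewrite mulrBr opprB addrCA expRD ler_wpM2r ?expR_ge0 //.
  apply: le_trans (ler_wpM2l (mulr_ge0 p0 _) H') _; first by rewrite subr_ge0.
  rewrite [leLHS]mulrA ler_wpM2r ?expR_ge0 //.
  rewrite [leRHS](_ : _ = p * (1 - r) + 2 * x * p); last by rewrite /x; ring.
  rewrite mulrDr mulr1 lerD2l.
  have : 0 <= x * p * r by rewrite !mulr_ge0.
  lra.
apply: le_trans (ler_sum _ (fun i _ => key i)) _.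
rewrite -mulr_suml big_split /= stage_fail_sum -mulr_sumr.
rewrite -[leRHS]mul1r ler_wpM2r ?expR_ge0 //; lra.
Qed.

End Stages.
End Visits.

(** * Return probabilities *)

Section OneDim.
Context {R : realType}.
Implicit Types (a k : nat) (y : int).

(** The probability that the simple walk on the integers started at 0 is at [y] after [a] steps, by
    its last step. *)
Fixpoint srw1 (a : nat) (y : int) : R :=
  if a is b.+1 then (srw1 b (y - 1) + srw1 b (y + 1)) / 2 else (y == 0)%:R.

Lemma srw1_ge0 a y : 0 <= srw1 a y.
Proof.
elim: a y => [|a IHa] y /=; first by rewrite ler0n.
by rewrite mulr_ge0 ?addr_ge0 ?invr_ge0.
Qed.

Lemma srw1_le1 a y : srw1 a y <= 1.
Proof.
elim: a y => [|a IHa] y /=; first by rewrite lern1 leq_b1.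
by rewrite ler_pdivrMr // mul1r [leRHS](_ : _ = 1 + 1) ?lerD.
Qed.

Lemma srw1_parity a (k : int) : srw1 a (2 * k - a%:Z + 1) = 0.
Proof.
elim: a k => [|a IHa] k /=; first by case: eqP => //; lia.
rewrite [_ - 1](_ : _ = 2 * (k - 1) - a%:Z + 1); last by lia.
rewrite [X in _ + srw1 _ X](_ : _ = 2 * k - a%:Z + 1); last by lia.
by rewrite !IHa addr0 mul0r.
Qed.

Lemma srw1_out a y : y < - a%:Z -> srw1 a y = 0.
Proof.
elim: a y => [|a IHa] y /= ya; first by case: eqP => //; lia.
by rewrite !IHa ?addr0 ?mul0r //; lia.
Qed.

(** Ending at [2k - a] takes exactly [k] upward steps; the recursion is Pascal's rule. *)
Lemma srw1_bin a k : srw1 a (2 * k%:Z - a%:Z) = 'C(a, k)%:R / 2 ^+ a.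
Proof.
elim: a k => [|a IHa] k /=.
  rewrite bin0n expr0 divr1; congr (_%:R); congr nat_of_bool.
  by apply/eqP/eqP; lia.
rewrite [X in _ + srw1 _ X](_ : _ = 2 * k%:Z - a%:Z); last by lia.
rewrite IHa; case: k => [|k].
  rewrite srw1_out; last by lia.
  by rewrite !bin0 exprS invfM; lra.
rewrite [_ - 1](_ : _ = 2 * k%:Z - a%:Z); last by lia.
by rewrite IHa binS natrD exprS invfM; lra.
Qed.

Lemma central_bin m :
  (m.+1 * 'C(m.+1.*2, m.+1) = 2 * m.*2.+1 * 'C(m.*2, m))%N.
Proof.
have h1 := mul_bin_diag m.+1.*2 m.
have h2 := mul_bin_down m.*2.+1 m.
rewrite /= in h1 h2.
have e : (m.*2.+1 - m = m.+1)%N by lia.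
rewrite e in h2.
rewrite -h1 doubleS.
apply/eqP; rewrite -(eqn_pmul2l (ltn0Sn m)); apply/eqP.
have -> : (m.+1 * (m.*2.+2 * 'C(m.*2.+1, m)) = m.*2.+2 * (m.+1 * 'C(m.*2.+1, m)))%N.
  by lia.
rewrite -h2; lia.
Qed.

(** The left-hand side decreases in [m]: consecutive even-time probabilities have ratio
    [(2m+1)/(2m+2)], and [(2m+1)(2m+3) <= (2m+2)^2]. *)
Lemma srw1_even_sq m : (srw1 m.*2 0) ^+ 2 * (m.*2.+1)%:R <= 1.
Proof.
have e k : srw1 k.*2 0 = 'C(k.*2, k)%:R / 2 ^+ k.*2.
  by rewrite -srw1_bin; congr srw1; lia.
elim: m => [|m IHm]; first by rewrite /= expr1n mulr1.
have -> : srw1 m.+1.*2 0 = srw1 m.*2 0 * ((m.*2.+1)%:R / (m.*2.+2)%:R).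
  rewrite !e doubleS 2!exprS.
  have /(congr1 (fun k => k%:R : R)) := central_bin m.
  rewrite doubleS !natrM => h.
  have m0 : (m.+1)%:R != 0 :> R by rewrite pnatr_eq0.
  have -> : 'C(m.*2.+2, m.+1)%:R = 2 * (m.*2.+1)%:R * 'C(m.*2, m)%:R / (m.+1)%:R :> R.
    by rewrite -h mulrAC mulfV // mul1r.
  have -> : (m.*2.+2)%:R = 2 * m.+1%:R :> R by rewrite -natrM; congr (_%:R); lia.
  have p0 : 2 ^+ m.*2 != 0 :> R by rewrite expf_neq0.
  by field; rewrite nat1r m0 p0.
rewrite exprMn -mulrA; apply: le_trans IHm.
rewrite ler_wpM2l ?sqr_ge0 //.
rewrite expr_div_n mulrAC ler_pdivrMr ?exprn_gt0 ?ltr0n //.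
rewrite -!natrX -!natrM ler_nat; lia.
Qed.

Lemma srw1_sq a : (srw1 a 0) ^+ 2 * (a.+1)%:R <= 1.
Proof.
rewrite -(odd_double_half a); case: (odd a); last by rewrite add0n; exact: srw1_even_sq.
rewrite !add1n [srw1 _ _](_ : _ = 0) ?expr0n ?mul0r //.
by rewrite -[RHS](srw1_parity a./2.*2.+1 a./2); congr srw1; lia.
Qed.

End OneDim.

(** * Reciprocal moments of multinomial counts *)

Section SizeBias.
Context {R : realType} {I : finType}.
Hypothesis I0 : (0 < #|I|)%N.
Local Notation d := (#|I|%:R : R).
Local Notation N := (fun (c : seq I) (j : I) => count_mem j c).

(** Each of the [n+1] positions carries the letter [i] with probability [1/d], and removing it
    leaves a uniform word of length [n]. The induction splits the count into the first letter and
    the rest. *)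
Lemma wavg_size_bias n (i : I) (g : (I -> nat) -> R) :
  wavg n.+1 (fun c => (N c i)%:R * g (N c)) =
  n.+1%:R / d * wavg n (fun c => g (fun j => ((i == j) + N c j)%N)).
Proof.
elim: n g => [|n IHn] g; rewrite wavgS.
  rewrite (bigD1 i) //= big1 ?addr0; last first.
    by move=> s si; rewrite wavg0 /N /= (negbTE si) mul0r.
  by rewrite !wavg0 /N /= eqxx mul1r [1%:R]mulr1n div1r.
transitivity (d^-1 * \sum_(s : I) ((s == i)%:R *
    wavg n.+1 (fun c => g (fun j => ((s == j) + N c j)%N)) +
    wavg n.+1 (fun c => (N c i)%:R * g (fun j => ((s == j) + N c j)%N)))).
  congr *%R; apply: eq_bigr => s _; rewrite -wavgZ -wavgD.
  by apply: eq_wavg => c _; rewrite -mulrDl -natrD.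
rewrite big_split /= (bigD1 i) //= eqxx mul1r big1 ?addr0; last first.
  by move=> s /negbTE ->; rewrite mul0r.
under [X in _ + X]eq_bigr => s _ do
  rewrite (IHn (fun h => g (fun j => ((s == j) + h j)%N))).
rewrite -mulr_sumr.
have -> : \sum_s wavg n (fun c => g (fun j => ((s == j) + ((i == j) + N c j))%N)) =
   d * wavg n.+1 (fun c => g (fun j => ((i == j) + N c j)%N)).
  rewrite wavgS mulrA mulfV ?mul1r; last by rewrite pnatr_eq0 -lt0n.
  apply: eq_bigr => s _; apply: eq_wavg => c _; congr g; apply: funext => j.
  by rewrite addnCA.
set w := wavg _ _.
have d0 : d != 0 by rewrite pnatr_eq0 -lt0n.
by rewrite -[n.+2%:R]natr1; field.
Qed.

(** Size biasing applied to [g h / h i] absorbs the reciprocal. Words without the letter [i]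
    contribute 0 on the biased side, whence an inequality. *)
Lemma wavg_count_inv n (i : I) (g : (I -> nat) -> R) :
  (forall h, 0 <= g h) -> (forall h, g (fun j => ((i == j) + h j)%N) = g h) ->
  wavg n (fun c => g (N c) / (N c i).+1%:R) <=
    d / n.+1%:R * wavg n.+1 (fun c => g (N c)).
Proof.
move=> g0 gi.
have d0 : d != 0 by rewrite pnatr_eq0 -lt0n.
have n0 : n.+1%:R != 0 :> R by rewrite pnatr_eq0.
have := wavg_size_bias n i (fun h => g h / (h i)%:R).
rewrite eqxx => h.
have -> : wavg n (fun c => g (N c) / (N c i).+1%:R) =
  d / n.+1%:R * wavg n.+1 (fun c => (N c i)%:R * (g (N c) / (N c i)%:R)).
  rewrite h mulrA [_ / _ * _](_ : _ = 1) ?mul1r; last by field; rewrite nat1r n0 d0.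
  by apply: eq_wavg => c _; rewrite gi.
rewrite ler_wpM2l ?divr_ge0 ?ler0n //; apply: wavg_le => c _.
have [->|Ni] := eqVneq (N c i) 0%N; first by rewrite mul0r.
by rewrite mulrCA mulfV ?mulr1 // pnatr_eq0.
Qed.

(** The reciprocals are removed one at a time; each removal lengthens the word by one letter and
    costs a factor at most [d / n.+1]. *)
Lemma wavg_inv3 n (i j k : I) : i != j -> i != k -> j != k ->
  wavg n (fun c => ((N c i).+1%:R * (N c j).+1%:R * (N c k).+1%:R)^-1) <=
    d ^+ 3 / n.+1%:R ^+ 3.
Proof.
move=> ij ik jk.
have d0 : 0 <= d by rewrite ler0n.
have le_inv p : d / (n.+1 + p)%:R <= d / n.+1%:R.
  by rewrite ler_wpM2l // lef_pV2 ?posrE ?ltr0n // ler_nat leq_addr.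
have h1 := wavg_count_inv n i (fun h => ((h j).+1%:R * (h k).+1%:R)^-1).
have h2 := wavg_count_inv n.+1 j (fun h => ((h k).+1%:R)^-1).
have h3 := wavg_count_inv n.+2 k (fun h => 1).
rewrite /= in h1 h2 h3.
apply: le_trans (_ : d / n.+1%:R * (d / n.+2%:R * (d / n.+3%:R)) <= _); last first.
  rewrite -!expr_div_n exprS expr2.
  have := le_inv 1%N; have := le_inv 2%N; rewrite addn2 addn1 => l2 l1.
  apply: ler_wpM2l; first by rewrite divr_ge0.
  by apply: ler_pM => //; rewrite divr_ge0.
apply: le_trans (_ : d / n.+1%:R *
    wavg n.+1 (fun c => ((N c j).+1%:R * (N c k).+1%:R)^-1) <= _).
  apply: le_trans (h1 _ _); last first.
  - by move=> h; rewrite (negbTE ij) (negbTE ik).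
  - by move=> h; rewrite invr_ge0 mulr_ge0.
  by apply: wavg_le => c _; rewrite -mulrA invfM mulrC.
rewrite ler_wpM2l ?divr_ge0 //.
apply: le_trans (_ : d / n.+2%:R * wavg n.+2 (fun c => ((N c k).+1%:R)^-1) <= _).
  apply: le_trans (h2 _ _); last first.
  - by move=> h; rewrite (negbTE jk).
  - by move=> h; rewrite invr_ge0.
  by apply: wavg_le => c _; rewrite invfM mulrC.
rewrite ler_wpM2l ?divr_ge0 //.
apply: le_trans (_ : d / n.+3%:R * wavg n.+3 (fun c : seq I => 1) <= _); last first.
  by rewrite (wavg_const I0) mulr1.
apply: le_trans (h3 _ _) => //.
by apply: wavg_le => c _; rewrite mul1r.
Qed.

End SizeBias.

(** * Return probabilities in dimension at least three *)

Section LocalBound.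
Context {R : realType} {d : nat}.
Hypothesis hd : (3 <= d)%N.

Definition srw_step (s : 'I_d * bool) : 'rV[int]_d :=
  if s.2 then basis_vec s.1 else - basis_vec s.1.

Lemma card_step_gt0 : (0 < #|{: 'I_d * bool}|)%N.
Proof. by rewrite card_prod card_ord card_bool muln_gt0 (leq_trans _ hd). Qed.

Lemma card_dir_gt0 : (0 < #|{: 'I_d}|)%N.
Proof. by rewrite card_ord (leq_trans _ hd). Qed.

Lemma srw_step_coord i b j :
  srw_step (i, b) 0 j = if i == j then (if b then 1 else - 1) else 0.
Proof.
rewrite /srw_step /basis_vec; case: b; rewrite /= !mxE eqxx eq_sym /=;
  by case: eqP => _; rewrite ?oppr0.
Qed.

(* Given the word [c] of directions, the coordinates are independent
   one-dimensional walks, the [i]-th one making [count_mem i c] steps. *)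
Lemma wavg_product n (a : 'I_d -> nat) (x : 'rV[int]_d) :
  wavg n (fun w => \prod_i srw1 (a i) (x 0 i - pos srw_step w 0 i) : R) =
  wavg n (fun c => \prod_i srw1 (a i + count_mem i c) (x 0 i) : R).
Proof.
elim: n a x => [|n IHn] a x.
  rewrite !wavg0 /pos big_nil; apply: eq_bigr => i _.
  by rewrite mxE subr0 addn0.
rewrite !wavgS.
transitivity ((#|{: 'I_d * bool}|%:R : R)^-1 * \sum_s wavg n (fun c =>
    \prod_i srw1 (a i + count_mem i c) ((x - srw_step s) 0 i))).
  congr *%R; apply: eq_bigr => s _; rewrite -IHn; apply: eq_wavg => w _.
  apply: eq_bigr => i _; congr srw1.
  by rewrite /pos big_cons !mxE opprD addrA.
have d0 : d%:R != 0 :> R by rewrite pnatr_eq0 -lt0n (leq_trans _ hd).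
rewrite -(pair_bigA _ (fun i b => wavg n (fun c =>
    \prod_j srw1 (a j + count_mem j c) ((x - srw_step (i, b)) 0 j)))) /=.
rewrite card_prod card_ord card_bool natrM invfM -mulrA; congr *%R.
rewrite mulr_sumr; apply: eq_bigr => i _; rewrite -wavg_sum -wavgZ.
apply: eq_wavg => c _; rewrite big_bool /=.
rewrite [in RHS](bigD1 i) //= eqxx addnCA add1n /=.
set A := (a i + count_mem i c)%N; set p := \prod_(j < d | j != i) _.
have E b : \prod_j srw1 (a j + count_mem j c) ((x - srw_step (i, b)) 0 j) =
    srw1 A (x 0 i - (if b then 1 else - 1)) * p :> R.
  rewrite (bigD1 i) //= 2!mxE srw_step_coord eqxx; congr (_ * _).
  apply: eq_bigr => j ji; rewrite [i == j]eq_sym (negbTE ji) add0n; congr srw1.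
  by rewrite 2!mxE srw_step_coord [i == j]eq_sym (negbTE ji) subr0.
by rewrite !E -mulrDl opprK mulrA [2^-1 * _]mulrC.
Qed.

Definition at0p n : R := wavg n (fun w => (pos srw_step w == 0)%:R).

(** For [a = 0] and [x = 0] each factor in [wavg_product] is the indicator that one coordinate is
    back at 0. *)
Lemma at0p_counts n :
  at0p n = wavg n (fun c : seq 'I_d => \prod_i srw1 (count_mem i c) 0).
Proof.
have := wavg_product n (fun=> 0%N) 0.
under [RHS]eq_wavg => c _ do under eq_bigr => i _ do rewrite add0n mxE.
move=> <-; apply: eq_wavg => w _; rewrite /=.
have [->|w0] := eqVneq (pos srw_step w) 0.
  by rewrite big1 // => i _; rewrite !mxE subr0.
have [i wi] : exists i, pos srw_step w 0 i != 0.
  apply/existsP; rewrite -negb_forall; apply: contra w0 => /forallP w0.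
  by apply/eqP/rowP => i; rewrite mxE; apply/eqP/w0.
by rewrite (bigD1 i) //= mxE sub0r oppr_eq0 (negbTE wi) mul0r.
Qed.

(* AM-GM with weight [t]; taking [t = n^(3/2)] balances both terms. *)
Lemma at0p_le n (t : R) : 0 < t ->
  at0p n <= (t * (d%:R ^+ 3 / n.+1%:R ^+ 3) + t^-1) / 2.
Proof.
move=> t0; rewrite at0p_counts.
pose i0 : 'I_d := Ordinal (leq_trans (isT : 0 < 3)%N hd).
pose i1 : 'I_d := Ordinal (leq_trans (isT : 1 < 3)%N hd).
pose i2 : 'I_d := Ordinal (leq_trans (isT : 2 < 3)%N hd).
have := @wavg_inv3 R 'I_d card_dir_gt0 n i0 i1 i2 isT isT isT.
rewrite card_ord => h.
rewrite ler_pdivlMr //; apply: le_trans (lerD (ler_wpM2l (ltW t0) h) (lexx _)).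
rewrite -wavgZ -(wavg_const card_dir_gt0 n t^-1) mulrC -wavgZ -wavgD.
apply: wavg_le => c _.
set N := fun i : 'I_d => count_mem i c.
rewrite -/(N i0) -/(N i1) -/(N i2).
pose u i : R := srw1 (N i) 0.
have u0 i : 0 <= u i by exact: srw1_ge0.
have u1 i : u i <= 1 by exact: srw1_le1.
have uN i : u i ^+ 2 <= (N i).+1%:R^-1.
  by rewrite -[leRHS]mul1r ler_pdivlMr ?ltr0n //; exact: srw1_sq.
(* Three coordinates already give the exponent 3/2; the other factors are at most 1. *)
have P3 : \prod_i u i <= u i0 * u i1 * u i2.
  rewrite (bigD1 i0) //= (bigD1 i1) //= (bigD1 i2) //= -!mulrA.
  do 2! rewrite ler_wpM2l //.
  by rewrite -[leRHS]mulr1 ler_wpM2l // prodr_ile1 // => i _; rewrite u0 u1.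
set v := u i0 * u i1 * u i2 in P3.
have v0 : 0 <= v by rewrite !mulr_ge0.
have v2 : v ^+ 2 <= ((N i0).+1%:R * (N i1).+1%:R * (N i2).+1%:R)^-1.
  by rewrite !invfM !exprMn !ler_pM // ?mulr_ge0 ?sqr_ge0.
apply: le_trans (_ : 2 * v <= _); first by rewrite ler_wpM2l.
apply: le_trans (lerD (ler_wpM2l (ltW t0) v2) (lexx _)).
rewrite -subr_ge0 (_ : _ - _ = t * (v - t^-1) ^+ 2).
  by apply: mulr_ge0; [exact: ltW | exact: sqr_ge0].
by field; rewrite gt_eqF.
Qed.

Lemma retp_step m : retp (R := R) srw_step m.+1 <= retp srw_step m + at0p m.+1.
Proof.
have V0 := card_step_gt0.
rewrite /retp /hitp /at0p -addn1 !wavg_cat -wavgD.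
apply: wavg_le => u _; rewrite -{1}[_%:R](wavg_const V0 1) -wavgD.
apply: wavg_le => v sv; rewrite visits_cat sub0r.
case: (ltnP 0 (visits srw_step 0 u)) => [u0|u0].
  by rewrite (leq_trans u0 (leq_addr _ _)) lerDl ler0n.
rewrite add0r; apply: ler_natb.
have -> : visits srw_step 0 u = 0%N by apply/eqP; rewrite -leqn0.
case: v sv => [//|s [|//]] _ /=.
rewrite add0n addn0 lt0b => /eqP e.
by rewrite /pos big_cat /= big_seq1 e subrr.
Qed.

(** Bounds the probability of a first return at a finite time after [m]; the order is that of the
    tail of the series of [n^(-3/2)]. *)
Definition ret_tail (m : nat) : R := (d%:R ^+ 3 + 1) / Num.sqrt m%:R.

Lemma at0p_tail m : (0 < m)%N -> at0p m.+1 <= ret_tail m - ret_tail m.+1.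
Proof.
move=> m0; rewrite /ret_tail -mulrBr.
set c := d%:R ^+ 3.
have c0 : 0 <= c by rewrite exprn_ge0.
set s := Num.sqrt m%:R; set s' := Num.sqrt m.+1%:R.
have s0 : 0 < s by rewrite sqrtr_gt0 ltr0n.
have ss : s <= s' by rewrite ler_wsqrtr // ler_nat.
have s'0 : 0 < s' by exact: lt_le_trans ss.
have sE : s ^+ 2 = m%:R by rewrite sqr_sqrtr.
have s'E : s' ^+ 2 = m.+1%:R by rewrite sqr_sqrtr.
have dif : s^-1 - s'^-1 >= (s' ^+ 3)^-1 / 2.
  have -> : s^-1 - s'^-1 = (s * s' * (s + s'))^-1.
    have e : s' ^+ 2 = s ^+ 2 + 1 by rewrite s'E sE natr1.
    apply: (mulIf (x := s * s' * (s + s'))); first by rewrite !mulf_neq0 ?gt_eqF ?addr_gt0.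
    rewrite mulVf ?mulf_neq0 ?gt_eqF ?addr_gt0 //.
    rewrite [LHS](_ : _ = s' ^+ 2 - s ^+ 2); last by field; rewrite !gt_eqF.
    by rewrite e addrC addKr.
  rewrite -invfM lef_pV2 ?posrE ?mulr_gt0 ?addr_gt0 ?exprn_gt0 //.
  have h1 : s * s' <= s' * s' by rewrite ler_wpM2r // ltW.
  have h2 : s * s' * (s + s') <= s' * s' * (s' + s').
    by apply: ler_pM => //; rewrite ?mulr_ge0 ?addr_ge0 ?lerD ?(ltW s0) ?(ltW s'0).
  by apply: le_trans h2 _; rewrite !exprS expr0 mulr1; lra.
have tpos : 0 < s' ^+ 3 by rewrite exprn_gt0.
(* With [t = (m+1)^(3/2)] both terms of [at0p_le] are at most multiples of [t^-1], which [dif]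
   compares with a telescoping difference. *)
apply: le_trans (at0p_le m.+1 _ tpos) _.
apply: le_trans (_ : (c + 1) * ((s' ^+ 3)^-1 / 2) <= _); last first.
  by rewrite ler_wpM2l // addr_ge0.
rewrite mulrA ler_wpM2r // mulrDl mul1r lerD2r -/c mulrCA ler_wpM2l //.
rewrite ler_pdivrMr ?exprn_gt0 ?ltr0n // ler_pdivlMl //.
by rewrite -exprD -[(3+3)%N]/(2 * 3)%N exprM s'E lerXn2r ?nnegrE // ler_nat.
Qed.

(** By [retp_step] and [at0p_tail], [retp n + ret_tail n] is nonincreasing in [n > 0]. *)
Lemma retp_le_tail m n : (0 < m)%N -> (m <= n)%N ->
  retp (R := R) srw_step n <= retp srw_step m + ret_tail m.
Proof.
move=> m0 mn; apply: le_trans (_ : retp srw_step n + ret_tail n <= _).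
  by rewrite lerDl divr_ge0 ?sqrtr_ge0 ?addr_ge0 ?exprn_ge0.
rewrite -(subnK mn); elim: (n - m)%N => [//|k IHk]; rewrite addSn.
apply: le_trans IHk; have := retp_step (k + m).
have : (0 < k + m)%N by rewrite addn_gt0 m0 orbT.
by move=> /at0p_tail; lra.
Qed.

Lemma retp_mono m n : (m <= n)%N -> retp (R := R) srw_step m <= retp srw_step n.
Proof.
have V0 := card_step_gt0.
move=> /subnKC <-; rewrite /retp /hitp wavg_cat; apply: wavg_le => u _.
rewrite -[leLHS](wavg_const V0 (n - m)); apply: wavg_le => v _.
by apply: ler_natb; rewrite visits_cat => /leq_trans; apply; rewrite leq_addr.
Qed.

End LocalBound.

(** * Thresholds and level times *)

Section PolynomialSums.
Context {R : realType}.

Lemma exprS_diff_le (k p : nat) :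
  k.+1%:R ^+ p.+1 - k%:R ^+ p.+1 <= p.+1%:R * k.+1%:R ^+ p :> R.
Proof.
elim: p => [|p IHp]; first by rewrite !expr1 expr0 mulr1 -natrB // subSnn.
have h : k%:R ^+ p.+1 <= k.+1%:R ^+ p.+1 :> R by rewrite lerXn2r ?nnegrE // ler_nat.
rewrite 2![_ ^+ p.+2]exprS [X in _ - X * _](_ : _ = k.+1%:R - 1); last first.
  by rewrite -natr1 addrK.
have := ler_wpM2l (ler0n R k.+1) IHp.
rewrite -[p.+2%:R]natr1 [X in _ <= (_ + 1) * X]exprS; move: h; rewrite [k.+1%:R ^+ p.+1]exprS.
nra.
Qed.

Lemma poly_geom_bounded (q : R) (p : nat) : 0 < q < 1 ->
  exists C : R, forall k, \sum_(i < k) i.+1%:R ^+ p * q ^+ i <= C.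
Proof.
move=> /andP[q0 q1]; have q1' : 0 < 1 - q by rewrite subr_gt0.
elim: p => [|p [C HC]].
  exists (1 - q)^-1 => k; rewrite -[leRHS]mul1r ler_pdivlMr //.
  have -> : \sum_(i < k) i.+1%:R ^+ 0 * q ^+ i = \sum_(i < k) q ^+ i.
    by apply: eq_bigr => i _; rewrite expr0 mul1r.
  rewrite -opprB mulrN mulrC -subrX1 opprB lerBlDr lerDl.
  by rewrite exprn_ge0 // ltW.
exists (p.+1%:R * C / (1 - q)) => k.
rewrite ler_pdivlMr //; apply: le_trans (ler_wpM2l (ler0n _ p.+1) (HC k)).
(* Abel summation *)
suff : (\sum_(i < k) i.+1%:R ^+ p.+1 * q ^+ i) * (1 - q) + k%:R ^+ p.+1 * q ^+ k
    <= p.+1%:R * \sum_(i < k) i.+1%:R ^+ p * q ^+ i.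
  apply: le_trans; rewrite lerDl mulr_ge0 ?exprn_ge0 //; exact: ltW.
elim: k => [|k IHk]; first by rewrite !big_ord0 mul0r mulr0 add0r expr0n mul0r.
rewrite !big_ord_recr /= [leRHS]mulrDr; apply: le_trans (lerD IHk (lexx _)).
have qk : 0 <= q ^+ k by rewrite exprn_ge0 // ltW.
have := ler_wpM2r qk (exprS_diff_le k p); rewrite [q ^+ k.+1]exprS.
move: (k.+1%:R ^+ p.+1) (k.+1%:R ^+ p) (k%:R ^+ p.+1) (q ^+ k) => x y z t.
by move: (p.+1%:R) (\sum_(i < k) _) => P S; lra.
Qed.

End PolynomialSums.

(** * Choice of the deadlines *)

Section Thresholds.
Context {R : realType} (r : nat -> R) (q C : R).
Hypothesis q01 : 0 < q < 1.
Hypothesis C0 : 0 <= C.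
Hypothesis rC : forall m, (0 < m)%N -> q <= r m + C / Num.sqrt m%:R.

(** Taken at [y = 1/(k+1)] and [z = 1/((k+1)(k+2))], so that [y - z = 1/(k+2)], this is the
    induction step for the product in [exists_thresholds]. *)
Lemma half_step (y z : R) : y <= 1 -> 0 <= z ->
  (1 + (y - z)) / 2 <= (1 + y) / 2 * (1 - z / 2).
Proof.
move=> y1 z0; have : 0 <= (1 - y) * z by rewrite mulr_ge0 ?subr_ge0.
by lra.
Qed.

Lemma exists_thresholds : exists mm : nat -> nat, exists A : R,
  [/\ forall i, (0 < mm i)%N, 0 < A,
      forall k, q ^+ k / 2 <= \prod_(i < k) r (mm i) &
      forall k, \sum_(i < k) q ^+ i * (\sum_(j < i.+1) mm j)%N%:R <= A].
Proof.
have /andP[q0 q1] := q01.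
pose N := (Num.truncn (2 * C / q)).+1.
have hN : 2 * C / q < N%:R by exact: truncnS_gt.
(* A perfect square of order [i^4]: its root is an integer, and as [2 * C <= q * N] the loss
   [C / sqrt (mm i)] is at most [q / (2(i+1)(i+2))], which is summable. *)
pose mm i := ((N * i.+2 ^ 2) ^ 2)%N.
(* The first [i+1] thresholds add up to order [i^5]; by [i+2 <= 2(i+1)] the sum is at most
   [B * (i+1)^5]. *)
have [D HD] := @poly_geom_bounded R q 5 q01.
pose B : R := (N ^ 2 * 32)%N%:R.
have D0 : 0 <= D by have := HD 0%N; rewrite big_ord0.
exists mm, (B * D + 1); split.
- by move=> i; rewrite !(expn_gt0, muln_gt0).
- by rewrite ltr_pwDr // mulr_ge0.
- move=> k.
  (* The extra factor falls from 1 at [k = 0] towards 1/2, which leaves room for the induction. *)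
  have : q ^+ k * ((1 + k.+1%:R^-1) / 2) <= \prod_(i < k) r (mm i).
    elim: k => [|k IHk]; first by rewrite big_ord0 expr0 mul1r invr1 -{1}[1]/(1%:R) divff.
    rewrite big_ord_recr /=.
    set x : R := (k.+1%:R * k.+2%:R)^-1.
    have x0 : 0 <= x by rewrite invr_ge0.
    have xE : k.+1%:R^-1 - k.+2%:R^-1 = x :> R.
      rewrite /x -[k.+2%:R]natr1; move: (k.+1%:R) (ltr0Sn R k) => y y0.
      by field; rewrite !gt_eqF // addr_gt0.
    have rk : q * (1 - x / 2) <= r (mm k).
      have mk : (0 < mm k)%N by rewrite !(expn_gt0, muln_gt0).
      have h := rC _ mk.
      have sq : Num.sqrt (mm k)%:R = (N * k.+2 ^ 2)%N%:R :> R.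
        by rewrite /mm natrX sqrtr_sqr ger0_norm.
      rewrite sq in h.
      suff : C / (N * k.+2 ^ 2)%N%:R <= q * (x / 2).
        by move: h; move: (C / _) (r _) => t rr; lra.
      have CN : 2 * C <= q * N%:R by rewrite [leRHS]mulrC -ler_pdivrMr // ltW.
      rewrite ler_pdivrMr ?ltr0n ?(muln_gt0, expn_gt0) // natrM.
      have : 1 <= x * (k.+2 ^ 2)%N%:R.
        rewrite mulrC ler_pdivlMr ?mulr_gt0 ?ltr0n // mul1r -natrM ler_nat; nia.
      move=> h1; have : q * N%:R * 1 <= q * N%:R * (x * (k.+2 ^ 2)%:R).
        by rewrite ler_wpM2l // mulr_ge0 // ltW.
      lra.
    have x1 : x <= 1.
      by rewrite invf_le1 ?mulr_gt0 ?ltr0n // -natrM ler1n muln_gt0.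
    have kk : k.+1%:R^-1 <= 1 :> R by rewrite invf_le1 ?ltr0n // ler1n.
    have k0 : 0 <= k.+1%:R^-1 :> R by rewrite invr_ge0.
    apply: le_trans (ler_pM _ _ IHk rk); last 2 first.
    - by rewrite mulr_ge0 ?exprn_ge0 ?divr_ge0 ?addr_ge0 // ltW.
    - by rewrite mulr_ge0 ?(ltW q0) // subr_ge0; lra.
    rewrite exprSr [leRHS]mulrACA ler_wpM2l ?mulr_ge0 ?exprn_ge0 ?(ltW q0) //.
    have -> : k.+2%:R^-1 = k.+1%:R^-1 - x :> R by rewrite -xE opprB addrC subrK.
    exact: half_step.
  apply: le_trans; rewrite ler_wpM2l ?exprn_ge0 ?(ltW q0) //.
  by rewrite -[leLHS]mul1r ler_wpM2r // lerDl invr_ge0.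
- move=> k; apply: le_trans (_ : B * D <= _); last by rewrite lerDl.
  apply: le_trans (ler_wpM2l _ (HD k)); last by [].
  rewrite mulr_sumr; apply: ler_sum => i _.
  rewrite mulrC mulrA ler_wpM2r ?exprn_ge0 ?(ltW q0) //.
  rewrite /B -natrX -natrM ler_nat.
  apply: (@leq_trans (\sum_(j < i.+1) N ^ 2 * i.+2 ^ 4)).
    apply: leq_sum => j _; rewrite /mm expnMn -expnM leq_mul2l leq_exp2r //.
    by rewrite ltnS ltn_ord orbT.
  rewrite sum_nat_const card_ord mulnCA -mulnA leq_mul2l; apply/orP; right.
  have h : (i.+2 <= 2 * i.+1)%N by lia.
  apply: (@leq_trans (i.+1 * (2 * i.+1) ^ 4)); first by rewrite leq_mul2l leq_exp2r ?h ?orbT.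
  by rewrite expnMn mulnCA -expnS leq_mul2r orbC.
Qed.

End Thresholds.

Lemma add4_le {R : realType} (x y z t k : R) : x + y + z + t <= k ->
  0 <= x -> 0 <= y -> 0 <= z -> 0 <= t -> [/\ x <= k, y <= k, z <= k & t <= k].
Proof. by move=> *; split; lra. Qed.

(** * Level times and their logarithms *)

Section Interpolation.
Context {R : realType} (q c : R).
Hypothesis q01 : 0 < q < 1.
Hypothesis c0 : 0 < c.

(* The exponent in the bound [2 * expR (- (c * q ^+ k * n%:R))] reaches
   [2 * ln k.+1] here, which makes it summable in [k]. *)
Definition level_time (k : nat) : nat :=
  (Num.truncn (2 * ln k.+1%:R / (c * q ^+ k))).+1.

Lemma level_time_gt k : 2 * ln k.+1%:R / (c * q ^+ k) < (level_time k)%:R.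
Proof. exact: truncnS_gt. Qed.

Lemma level_time_unbounded n : exists k, (n < level_time k)%N.
Proof.
have /andP[q0 q1] := q01.
(* This makes [2 * ln k.+1] exceed [c * n]; dividing by [q ^+ k <= 1] only enlarges it. *)
exists (Num.truncn (expR (c * n%:R / 2))); set k := Num.truncn _.
have h : expR (c * n%:R / 2) < k.+1%:R by exact: truncnS_gt.
rewrite -(ltr_nat R); apply: le_lt_trans (level_time_gt k).
rewrite ler_pdivlMr ?mulr_gt0 ?exprn_gt0 //.
apply: le_trans (_ : n%:R * c <= _).
  apply: ler_wpM2l => //; rewrite -[leRHS]mulr1; apply: ler_wpM2l; first exact: ltW.
  by rewrite exprn_ile1 // ltW.
have : c * n%:R / 2 <= ln k.+1%:R.
  by rewrite -[leLHS]expRK ler_ln ?posrE ?expR_gt0 ?ltr0n // ltW.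
lra.
Qed.

(** Here [k.+1] is the least index beyond [K] whose level time exceeds [n]. *)
Lemma level_time_bracket K n : (level_time K <= n)%N ->
  exists k, [/\ (K <= k)%N, (level_time k <= n)%N & (n < level_time k.+1)%N].
Proof.
move=> Kn.
have ex : exists j, (K < j)%N && (n < level_time j)%N.
  (* Exceeding every level time up to [K] forces the index beyond [K]. *)
  have [k nk] := level_time_unbounded (maxn n (\max_(i < K.+1) level_time i)).
  exists k; move: nk; rewrite gtn_max => /andP[-> h]; rewrite andbT ltnNge.
  apply: contraL h => kK; rewrite -leqNgt.
  by rewrite (leq_bigmax (Ordinal (kK : (k < K.+1)%N))).
case: (ex_minnP ex) => -[//|j] /andP[Kj nj] jmin.
exists j; split => //; rewrite leqNgt; apply/negP => jn.
have KjS : (K < j)%N.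
  rewrite ltn_neqAle -ltnS Kj andbT; apply/eqP => e.
  by move: jn; rewrite -e ltnNge Kn.
by have := jmin j; rewrite KjS jn ltnn => /(_ isT).
Qed.

(** With [l = -1 / ln q], the bound [n < level_time k.+1] gives [l * ln n <= k + l * ln (ln k.+2)]
    up to a constant. Since [ln (ln n)] is at least [ln k] up to a constant, one of its two copies
    pays for the double logarithm and the other for the constants. *)
Lemma level_time_log : exists K : nat, forall k n, (K <= k)%N ->
  (level_time k <= n)%N -> (n < level_time k.+1)%N ->
  0 <= ln (ln n%:R : R) /\ - 1 / ln q * ln n%:R - 2 * ln (ln n%:R) <= k%:R.
Proof.
have /andP[q0 q1] := q01.
pose b := - ln q; have b0 : 0 < b by rewrite oppr_gt0 ln_lt0.
pose l := b^-1; have l0 : 0 < l by rewrite invr_gt0.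
have lE : - 1 / ln q = l by rewrite /l /b invrN mulN1r.
pose a : R := ln (2 / c).
pose D := l * a + l * ln l + 3 - 2 * ln (b / 2).
(* The terms yield, in this order, [ln k.+1 >= 1], [|a| <= k * b / 2], [1 <= k * b / 2] and
   [D <= ln k]. *)
pose K := (Num.truncn (expR 1 + 2 * `|a| / b + 2 / b + expR D)).+1.
exists K => k n Kk kn nk.
have kK : expR 1 + 2 * `|a| / b + 2 / b + expR D <= k%:R.
  by apply: le_trans (ltW (truncnS_gt _)) _; rewrite ler_nat.
have t1 : 0 <= 2 * `|a| / b by rewrite divr_ge0 ?mulr_ge0 // ltW.
have t2 : 0 <= 2 / b by rewrite divr_ge0 // ltW.
have t3 : 0 <= expR D by exact: expR_ge0.
have t4 : 1 <= expR 1 :> R by rewrite -expR0 ler_expR.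
have [ke ka kb kD] := add4_le _ _ _ _ _ kK (le_trans ler01 t4) t1 t2 t3.
have {}ka : `|a| <= k%:R * b / 2.
  by move: ka; rewrite ler_pdivrMr // mulrC ler_pdivlMr.
have {}kb : 1 <= k%:R * b / 2.
  by move: kb; rewrite ler_pdivrMr // ler_pdivlMr // mul1r.
have k0 : 0 < k%:R :> R by apply: lt_le_trans ke; exact: expR_gt0.
have {}kD : D <= ln k%:R.
  by rewrite -[leLHS]expRK ler_ln ?posrE ?expR_gt0.
have kln : 1 <= ln (k.+1%:R : R).
  rewrite -[leLHS]expRK ler_ln ?posrE ?expR_gt0 ?ltr0n //.
  by apply: le_trans ke _; rewrite ler_nat.
have lnlvl j : 0 < ln (j.+1%:R : R) ->
    ln (2 * ln j.+1%:R / (c * q ^+ j)) = a + ln (ln j.+1%:R) + j%:R * b.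
  move=> lj; have qj : 0 < q ^+ j by rewrite exprn_gt0.
  rewrite [X in ln X](_ : _ = (2 / c) * ln j.+1%:R * (q ^+ j)^-1); last first.
    by field; rewrite !gt_eqF.
  have ac : 0 < 2 / c by rewrite divr_gt0.
  rewrite lnM ?posrE ?invr_gt0 //; last by rewrite mulr_gt0.
  rewrite (@lnM _ (2 / c)) ?posrE // lnV ?posrE // lnXn // -/a.
  by rewrite /b mulrN mulr_natl.
have lk2 : ln (k.+2%:R : R) <= ln k%:R + 2.
  have k3 : (k.+2%:R : R) <= k%:R * 3.
    by rewrite -natr1 -natr1; lra.
  apply: le_trans (_ : ln (k%:R * 3 : R) <= _).
    by rewrite ler_ln ?posrE ?ltr0n ?mulr_gt0.
  rewrite lnM ?posrE // lerD2l; rewrite (_ : 3 = 1 + 2); last by lra.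
  by apply: le_ln1Dx; lra.
have lnk2 : 1 <= ln (k.+2%:R : R).
  by apply: le_trans kln _; rewrite ler_ln ?posrE ?ltr0n // ler_nat.
have n0 : 0 < n%:R :> R by rewrite ltr0n; apply: leq_trans kn.
have up : ln (n%:R : R) <= a + ln (ln k.+2%:R) + k.+1%:R * b.
  rewrite -lnlvl ?(lt_le_trans ltr01) // ler_ln ?posrE //; last first.
    by rewrite divr_gt0 ?mulr_gt0 ?exprn_gt0 // (lt_le_trans ltr01).
  (* A level time is a truncation plus one, so [n] is at most the truncation and thus at most the
     real number. *)
  rewrite -truncn_ge_nat // divr_ge0 ?mulr_ge0 ?exprn_ge0 ?(ltW q0) ?(ltW c0) //.
  exact: le_trans ler01 lnk2.
have lo : k%:R * b / 2 <= ln (n%:R : R).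
  apply: le_trans (_ : a + ln (ln k.+1%:R) + k%:R * b <= _).
    have := ln_ge0 kln; have := ler_norm (- a); rewrite normrN; lra.
  rewrite -lnlvl ?(lt_le_trans ltr01) // ler_ln ?posrE //.
    by apply: le_trans (ltW (level_time_gt k)) _; rewrite ler_nat.
  by rewrite divr_gt0 ?mulr_gt0 ?exprn_gt0 // (lt_le_trans ltr01).
have lo2 : ln k%:R + ln (b / 2) <= ln (ln (n%:R : R)).
  rewrite -lnM ?posrE ?divr_gt0 // ler_ln ?posrE ?mulr_gt0 ?divr_gt0 //.
    by rewrite mulrA.
  by apply: lt_le_trans lo; lra.
split; first by rewrite ln_ge0 //; lra.
rewrite lE.
have lb : l * b = 1 by rewrite /l mulVf ?gt_eqF.
(* From [ln y < y] at [y = ln k.+2 / l]. *)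
have lnl : l * ln (ln (k.+2%:R : R)) <= ln k.+2%:R + l * ln l.
  have lk0 : 0 < ln (k.+2%:R : R) by exact: lt_le_trans lnk2.
  have -> : ln (ln (k.+2%:R : R)) = ln (ln k.+2%:R / l) + ln l.
    by rewrite -lnM ?posrE ?divr_gt0 // divfK // gt_eqF.
  rewrite mulrDr lerD2r.
  have h := ltW (@ln_sublinear R (ln k.+2%:R / l) _).
  apply: le_trans (ler_wpM2l (ltW l0) (h _)) _; first by rewrite divr_gt0.
  by rewrite mulrCA mulfV ?mulr1 // gt_eqF.
have upl := ler_wpM2l (ltW l0) up.
have e : l * (k.+1%:R * b) = k%:R + 1 by rewrite mulrCA lb mulr1 natr1.
move: kD upl; rewrite /D !mulrDr e; lra.
Qed.

End Interpolation.

(** * The law of the walk *)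

Section DiscreteMeasurability.
Context {disp : measure_display} {T : measurableType disp}.

Lemma measurable_countable_preimage (U : countType) (f : T -> U) :
  (forall u, measurable (f @^-1` [set u])) -> forall B, measurable (f @^-1` B).
Proof.
move=> mf B.
rewrite (_ : f @^-1` B = \bigcup_u (f @^-1` ([set u] `&` B))).
  apply: countable_bigcupT_measurable => [|u]; first exact: countableP.
  have [Bu|Bu] := pselect (B u).
    rewrite (_ : _ `&` _ = [set u]) //.
    by apply/seteqP; split => [v []|v ->].
  rewrite (_ : _ `&` _ = set0) ?preimage_set0 //.
  by apply/seteqP; split => [v [-> ]|].
apply/seteqP; split => [w Bw|w [u _ []] //].
by exists (f w).
Qed.

(** [K] is the least index, or 0 if there is none; its level sets are countable Boolean combinations
    of the [D n]. It turns an eventual property into a random index. *)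
Lemma exists_measurable_first (D : nat -> set T) :
  (forall n, measurable (D n)) ->
  exists K : T -> nat, (forall B, measurable (K @^-1` B)) /\
    forall w, (exists n, D n w) -> D (K w) w.
Proof.
move=> mD.
have H w : exists n, (D n w /\ forall j, (j < n)%N -> ~ D j w) \/
    (n = 0%N /\ forall j, ~ D j w).
  have [[n Dn]|nD] := pselect (exists n, D n w).
    have ex : exists n, `[< D n w >] by exists n; apply/asboolP.
    case: (ex_minnP ex) => m /asboolP Dm mmin; exists m; left; split => // j jm /asboolP.
    by move=> /mmin; rewrite leqNgt jm.
  by exists 0%N; right; split => // j Dj; apply: nD; exists j.
have [K HK] := choice H; exists K; split; last first.
  by move=> w [n Dn]; have [[]//|[_ /(_ n)]] := HK w.
apply: measurable_countable_preimage => n.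
rewrite (_ : K @^-1` [set n] = (D n `&` \bigcap_(j in [set j | (j < n)%N]) ~` D j) `|`
    (if n == 0%N then \bigcap_j ~` D j else set0)).
  apply: measurableU.
    apply: measurableI => //; apply: bigcap_measurableType => j _; exact: measurableC.
  by case: ifP => // _; apply: bigcap_measurableType => j _; exact: measurableC.
apply/seteqP; split => w.
  move=> /= <-; have [[DK nD]|[K0 nD]] := HK w; first by left.
  by right; rewrite K0 eqxx => j _; exact: nD.
move=> /= [[Dn nD]|].
  have [[DK nK]|[K0 nK]] := HK w; last by have := nK n.
  have [kn|nk|//] := ltngtP (K w) n; first by have := nD _ kn.
  by have := nK _ nk.
case: ifP => // /eqP -> nD; have [[DK nK]|[//]] := HK w.
by have := nD (K w) I.
Qed.

End DiscreteMeasurability.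

(** * Transfer of probabilities from the walk to words *)

Section WalkLaw.
Context {disp : measure_display} {Omega : measurableType disp} {R : realType}.
Context {P : probability Omega R} {d : nat}.
Hypothesis hd : (3 <= d)%N.
Context {S : nat -> Omega -> 'rV[int]_d}.
Hypothesis hS : simple_random_walk P S.
Local Notation V := ('I_d * bool)%type.
Local Notation stp := (@srw_step d).

Definition trajectory n w : seq 'rV[int]_d := mkseq (fun j => S j w) n.

Lemma trajectoryS n w : trajectory n.+1 w = rcons (trajectory n w) (S n w).
Proof. exact: mkseqS. Qed.

Lemma measurable_trajectory n (B : set (seq 'rV[int]_d)) :
  measurable (trajectory n @^-1` B).
Proof.
have [_ mS _ _] := hS.
apply: measurable_countable_preimage => l {B}.
elim: n l => [|n IHn] l.
  have [->|l0] := eqVneq l [::].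
    by rewrite (_ : _ @^-1` _ = setT) //; apply/seteqP; split.
  rewrite (_ : _ @^-1` _ = set0) //; apply/seteqP; split => // w /= e.
  by rewrite -e eqxx in l0.
case/lastP: l => [|l x].
  by rewrite (_ : _ @^-1` _ = set0) //; apply/seteqP; split.
rewrite (_ : _ @^-1` _ = trajectory n @^-1` [set l] `&` S n @^-1` [set x]).
  by apply: measurableI; [exact: IHn|exact: mS].
apply/seteqP; split => w.
  move=> e; have : trajectory n.+1 w = rcons l x by [].
  by rewrite trajectoryS => /rcons_inj[e1 e2]; split.
by move=> [e1 e2]; rewrite /preimage /mkset -e1 -e2 -trajectoryS.
Qed.

(** Finite sequences of lattice points are countable, so an event decided by the positions at times
    0 to [n-1] is a countable union of atoms. *)
Lemma measurable_of_trajectory n (A : set Omega) :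
  (forall w w', trajectory n w = trajectory n w' -> A w -> A w') -> measurable A.
Proof.
move=> HA; rewrite (_ : A = trajectory n @^-1` (trajectory n @` A)).
  exact: measurable_trajectory.
apply/seteqP; split => w /=; first by move=> Aw; exists w.
by move=> [w' Aw' e]; apply: HA Aw'.
Qed.

Lemma trajectory_inj n j w w' :
  trajectory n w = trajectory n w' -> (j < n)%N -> S j w = S j w'.
Proof. by move=> /(congr1 (fun l => nth 0 l j)) + jn; rewrite !nth_mkseq. Qed.

Lemma measurable_walk_step k (B : set 'rV[int]_d) :
  measurable (walk_step S k @^-1` B).
Proof.
apply: (@measurable_of_trajectory k.+2) => w w' e.
by rewrite /= /walk_step !(trajectory_inj _ _ _ _ e).
Qed.

Definition follows (u : seq V) : set Omega :=
  [set w | forall j, (j < size u)%N -> walk_step S j w = nth 0 (map stp u) j].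

Lemma measurable_follows u : measurable (follows u).
Proof.
apply: (@measurable_of_trajectory (size u).+1) => w w' e H j ju.
rewrite -H // /walk_step !(trajectory_inj _ _ _ _ e) ?ltnS //; exact: ltnW.
Qed.

Lemma follows_rcons u s :
  follows (rcons u s) = follows u `&` walk_step S (size u) @^-1` [set stp s].
Proof.
apply/seteqP; split => w.
  move=> H; split => [j ju|].
    have := H j; rewrite size_rcons ltnS map_rcons nth_rcons size_map ju.
    by apply; exact: ltnW.
  have := H (size u); rewrite size_rcons ltnS map_rcons nth_rcons size_map ltnn eqxx.
  exact.
move=> [H Hs] j; rewrite size_rcons ltnS map_rcons nth_rcons size_map.
by rewrite leq_eqVlt => /orP[/eqP ->|ju]; rewrite ?ltnn ?eqxx // ju H.
Qed.

Lemma P_walk_step k (s : V) :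
  P (walk_step S k @^-1` [set stp s]) = ((#|{: V}|%:R)^-1)%:E.
Proof.
have [_ _ /(_ k) HP _] := hS.
rewrite card_prod card_ord card_bool mulnC natrM.
by case: s => i []; have [h1 h2] := HP i.
Qed.

Lemma P_follows u : P (follows u) = ((#|{: V}|%:R)^-1 ^+ size u)%:E.
Proof.
have [_ _ _ indep] := hS.
pose J := [fset j in iota 0 (size u)]%fset.
rewrite (_ : follows u = \bigcap_(j in [set` J])
    (walk_step S j @^-1` [set nth 0 (map stp u) j])); last first.
  apply/seteqP; split => w H j.
    by rewrite /= !inE mem_iota add0n => /= /H.
  by move=> ju; apply: H; rewrite /= !inE mem_iota.
rewrite indep.
have e : {in J, forall j, P (walk_step S j @^-1` [set nth 0 (map stp u) j]) =
   ((#|{: V}|%:R)^-1)%:E}.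
  move=> j; rewrite !inE mem_iota add0n /= => ju.
  case: u ju => // s0 u ju in J *; rewrite (nth_map s0) //; exact: P_walk_step.
rewrite (eq_big_seq _ e) prodEFin big_const_seq count_predT iter_mulr_1.
by rewrite card_fseq undup_id ?iota_uniq // size_iota.
Qed.

Lemma srw_step_inj : injective stp.
Proof.
move=> [i b] [i' b'] e.
have := srw_step_coord i b i; rewrite e srw_step_coord eqxx.
by case: eqP => [->|_]; case: b e => e; case: b' e => e.
Qed.

(** The [2d] unit steps have total probability 1, so the event of any other step is null. *)
Lemma P_split_step (B : set Omega) k : measurable B ->
  P B = \sum_(s : V) P (B `&` walk_step S k @^-1` [set stp s]).
Proof.
move=> mB; pose E s := walk_step S k @^-1` [set stp s].
have mE s : measurable (E s) by exact: measurable_walk_step.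
have tE (A : set Omega) : trivIset setT (fun s => A `&` E s).
  by apply/trivIsetP => s s' _ _; apply: contraNeq => /set0P[w [[_ e] [_ e']]];
    apply/eqP/srw_step_inj; rewrite -e -e'.
have sumE (A : set Omega) : measurable A ->
    P (A `&` \bigcup_s E s) = \sum_(s : V) P (A `&` E s).
  move=> mA; rewrite setI_bigcupr measure_fin_bigcup //.
  - rewrite (fsbigE (index_enum {: V})) ?index_enum_uniq //.
      by apply: eq_bigl => s; rewrite in_setT.
    by move=> s _; rewrite mem_index_enum.
  - exact: finite_finset.
  - by move=> s _; exact: measurableI.
have mU : measurable (\bigcup_s E s).
  by apply: fin_bigcup_measurable => // s _.
rewrite -sumE //.
have U1 : P (\bigcup_s E s) = 1%E.
  rewrite -[\bigcup_s _]setTI sumE //.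
  under eq_bigr => s _ do rewrite setTI P_walk_step.
  rewrite sumEFin sumr_const -[_ *+ _]mulr_natl mulfV //.
  by rewrite pnatr_eq0 -lt0n card_step_gt0.
rewrite -[in LHS](setIT B) -(setUv (\bigcup_s E s)) setIUr measureU.
- rewrite [X in (_ + X)%E](_ : _ = 0%E) ?adde0 //.
  apply/eqP; rewrite eq_le measure_ge0 andbT.
  apply: le_trans (_ : P (~` \bigcup_s E s) <= _)%E.
    have mC := measurableC mU.
    by apply: le_measure; [exact/mem_set/measurableI|exact/mem_set|exact: subIsetr].
  by rewrite probability_setC // U1 subee.
- exact: measurableI.
- by apply: measurableI => //; exact: measurableC.
- by rewrite setIACA setICr setI0.
Qed.

(** [Q] has to decide [A] only on paths that follow some word, which is almost every path. The
    induction is on the number of letters still free, starting from complete words. *)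
Lemma P_wavg n (Q : pred (seq V)) (A : set Omega) : measurable A ->
  (forall u w, size u = n -> follows u w -> (A w <-> Q u)) ->
  P A = (wavg n (fun u => (Q u)%:R))%:E.
Proof.
move=> mA AQ.
suff H m u : (size u + m)%N = n -> P (A `&` follows u) =
    ((#|{: V}|%:R)^-1 ^+ size u * wavg m (fun v => (Q (u ++ v))%:R))%:E.
  have := H n [::] (add0n n); rewrite expr0 mul1r /= => <-; congr (P _).
  by rewrite (_ : follows [::] = setT) ?setIT //; apply/seteqP; split.
elim: m u => [|m IHm] u um.
  rewrite addn0 in um; rewrite wavg0 cats0; case: (boolP (Q u)) => Qu.
    rewrite mulr1 -P_follows; congr (P _); apply/seteqP; split => [w []//|w uw].
    by split => //; apply/(AQ u w).
  rewrite mulr0 -[RHS](measure0 P); congr (P _); apply/seteqP; split => // w [Aw uw].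
  by move: Qu; rewrite (iffLR (AQ u w um uw) Aw).
rewrite (P_split_step _ (size u)); last by apply: measurableI => //; exact: measurable_follows.
under eq_bigr => s _.
  rewrite -setIA -follows_rcons IHm; last by rewrite size_rcons addSnnS.
  over.
rewrite sumEFin wavgS; congr (_%:E); rewrite mulrA -exprSr mulr_sumr.
apply: eq_bigr => s _; rewrite size_rcons; congr (_ * _).
by apply: eq_wavg => v _; rewrite cat_rcons.
Qed.

Lemma walk_follows u w : follows u w -> S (size u) w = pos stp u.
Proof.
have [S0 _ _ _] := hS.
elim/last_ind: u => [|u s IHu]; first by rewrite /pos big_nil S0.
rewrite follows_rcons => -[/IHu Su /= Xs].
rewrite size_rcons /pos -cats1 big_cat big_seq1 -/(pos stp u) -Su -Xs.
by rewrite /walk_step /= addrC subrK.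
Qed.

Lemma local_time_follows x u w : follows u w -> local_time S x (size u) w = visits stp x u.
Proof.
elim/last_ind: u => [|u s IHu]; first by rewrite /local_time big_nil.
move=> H; have /walk_follows Se := H; move: H; rewrite follows_rcons => -[/IHu H _].
rewrite size_rcons /local_time big_nat_recr //= -/(local_time S x (size u) w) H.
rewrite -cats1 visits_cat /= addn0; congr (_ + _)%N.
rewrite -(size_rcons u s) Se /pos -cats1 big_cat big_seq1 /= -/(pos stp u).
by congr nat_of_bool; apply/eqP/eqP => [<-|->]; rewrite addrC ?addrK ?subrK.
Qed.

Lemma local_time_trajectory x n w w' :
  trajectory n.+1 w = trajectory n.+1 w' -> local_time S x n w = local_time S x n w'.
Proof.
move=> e; rewrite /local_time; apply: eq_big_nat => k /andP[_ kn].
by rewrite (trajectory_inj _ _ _ _ e).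
Qed.

Definition all_light k n : set Omega :=
  [set w | forall x, (local_time S x n w < k)%N].

Lemma measurable_all_light k n : measurable (all_light k n).
Proof.
apply: (@measurable_of_trajectory n.+1) => w w' e H x.
by rewrite -(local_time_trajectory _ _ _ _ e).
Qed.

Lemma P_all_light k n : P (all_light k n) = (lightp stp k n)%:E.
Proof.
apply: P_wavg; first exact: measurable_all_light.
move=> u w <- uw; split => [H|/asboolP H x].
  by apply/asboolP => x; rewrite -(local_time_follows x u w uw).
by rewrite (local_time_follows x u w uw).
Qed.

Definition no_return n : set Omega := [set w | local_time S 0 n w = 0%N].

Lemma measurable_no_return n : measurable (no_return n).
Proof.
apply: (@measurable_of_trajectory n.+1) => w w' e.
by rewrite /no_return /= (local_time_trajectory _ _ _ _ e).
Qed.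

Lemma P_no_return n : P (no_return n) = (1 - retp stp n)%:E.
Proof.
rewrite (@P_wavg n (fun u => ~~ (0 < visits stp 0 u)%N)).
- congr (_%:E); rewrite /retp /hitp -wavgB1 ?card_step_gt0 //; apply: eq_wavg => u _.
  by case: (0 < _)%N; rewrite ?subrr ?subr0.
- exact: measurable_no_return.
- move=> u w <- uw; rewrite /no_return /= local_time_follows // lt0n negbK.
  by split=> /eqP.
Qed.

Lemma escape_bigcap :
  [set w | forall k : nat, (0 < k)%N -> S k w <> S 0%N w] = \bigcap_n no_return n.
Proof.
have [S0 _ _ _] := hS.
apply/seteqP; split => w /= H.
  move=> n _; rewrite /no_return /= /local_time big_nat big1 // => k /andP[k0 _].
  by have := H k k0; rewrite S0 => /eqP/negbTE ->.
move=> k k0; have := H k I; rewrite /no_return /= /local_time big_nat_recr //=.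
by move=> /eqP; rewrite addn_eq0 S0 eqb0 => /andP[_ /eqP].
Qed.

Lemma no_return_anti m n : (m <= n)%N -> no_return n `<=` no_return m.
Proof.
move=> mn w; rewrite /no_return /= /local_time (@big_cat_nat _ _ _ m.+1) //=.
by move=> /eqP; rewrite addn_eq0 => /andP[/eqP].
Qed.

Lemma no_return_cvg :
  ((1 - retp stp n)%:E @[n --> \oo] --> (escape_prob P S)%:E)%E.
Proof.
have -> : (escape_prob P S)%:E = P (\bigcap_n no_return n).
  by rewrite /escape_prob escape_bigcap fineK // fin_num_measure //;
    apply: bigcap_measurableType => n _; exact: measurable_no_return.
have := @nonincreasing_cvg_mu _ _ _ P no_return.
have -> : P \o no_return = fun n => (1 - retp stp n)%:E.
  by apply: funext => n; rewrite /= P_no_return.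
apply.
- by rewrite [X in (X < _)%E](P_no_return 0) ltry.
- exact: measurable_no_return.
- by apply: bigcap_measurableType => n _; exact: measurable_no_return.
- by move=> m n mn; apply/subsetPset; exact: no_return_anti.
Qed.

(** The limit [n -> oo] in [retp_le_tail]: the chance of a return within [m] steps falls short of
    that of any return by at most [ret_tail m]. *)
Lemma escape_prob_bounds m : (0 < m)%N ->
  1 - retp stp m - ret_tail (d := d) m <= escape_prob P S.
Proof.
move=> m0; rewrite -lee_fin -(cvg_lim _ no_return_cvg) //.
apply: lime_ge; first by apply: cvgP no_return_cvg.
exists m => // n /= mn; rewrite lee_fin.
have := retp_le_tail (R := R) hd m n m0 mn; lra.
Qed.

Lemma escape_prob_le m : escape_prob P S <= 1 - retp stp m.
Proof.
rewrite -lee_fin -(cvg_lim _ no_return_cvg) //.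
apply: lime_le; first by apply: cvgP no_return_cvg.
exists m => // n /= mn; rewrite lee_fin lerB // retp_mono //.
Qed.

Lemma escape_prob_ge0 : 0 <= escape_prob P S.
Proof. by rewrite fine_ge0 // measure_ge0. Qed.

End WalkLaw.

(** * Almost sure lower bound *)

Section LightDecay.
Context {R : realType} {d : nat}.
Hypothesis hd : (3 <= d)%N.
Variable q : R.
Hypothesis q01 : 0 < q < 1.
Hypothesis retq : forall m, retp (@srw_step d) m <= q.
Hypothesis qret : forall m, (0 < m)%N ->
  q <= retp (@srw_step d) m + ret_tail (d := d) m.

Lemma lightp_exp_decay : exists c : R, 0 < c /\
  forall k n, lightp (@srw_step d) k n <= 2 * expR (- (c * q ^+ k * n%:R)).
Proof.
have V0 := card_step_gt0 hd; have /andP[q0 q1] := q01.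
have C0 : 0 <= d%:R ^+ 3 + 1 :> R by rewrite addr_ge0 // exprn_ge0.
have [mm [A [mm0 A0 Qlow Msum]]] := @exists_thresholds R _ q _ q01 C0 qret.
have r0 m : 0 <= retp (R := R) (@srw_step d) m by exact: retp_ge0.
(* Chosen so that [2 * (c * q ^+ k) * A = q ^+ k / 2], the lower bound for [stage_prob k]. *)
pose c := (4 * A)^-1; have c0 : 0 < c by rewrite invr_gt0 mulr_gt0.
exists c; split => // k n.
have cA : c * A = 4^-1 by rewrite /c invfM -mulrA mulVf ?mulr1 // gt_eqF.
have qk0 : 0 <= q ^+ k by rewrite exprn_ge0 // ltW.
have th0 : 0 <= c * q ^+ k by rewrite mulr_ge0 // ltW.
have thM : c * q ^+ k * (stage_end mm k)%:R <= 2^-1.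
  case: k {qk0 th0} => [|k]; first by rewrite /stage_end big_ord0 mulr0.
  (* This is the last summand of [Msum] alone. *)
  have h : q ^+ k * (stage_end mm k.+1)%:R <= A.
    apply: le_trans (Msum k.+1); rewrite big_ord_recr /= lerDr.
    by apply: sumr_ge0 => i _; rewrite mulr_ge0 ?exprn_ge0 // ltW.
  have h0 : 0 <= q ^+ k * (stage_end mm k.+1)%:R.
    by rewrite mulr_ge0 ?exprn_ge0 // ltW.
  rewrite exprS; set y := q ^+ k * _ in h h0.
  rewrite (_ : _ * _ = c * (q * y)); last by rewrite /y; ring.
  apply: le_trans (_ : c * A <= _); last by rewrite cA; lra.
  apply: ler_wpM2l; [exact: ltW|apply: le_trans h].
  by rewrite -[leRHS]mul1r ler_wpM2r // ltW.
have Qsum : 2 * (c * q ^+ k) *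
    (\sum_(i < k) stage_prob (@srw_step d) mm i * (stage_end mm i.+1)%:R)
    <= stage_prob (R := R) (@srw_step d) mm k.
  apply: le_trans (Qlow k); apply: le_trans (_ : 2 * (c * q ^+ k) * A <= _).
    rewrite ler_wpM2l ?mulr_ge0 // ?(ltW c0) //; apply: le_trans (Msum k).
    (* No return probability exceeds [q], so [stage_prob i <= q ^+ i]. *)
    apply: ler_sum => i _; rewrite ler_wpM2r //.
    rewrite (_ : q ^+ i = \prod_(j < i) q); last by rewrite prodr_const card_ord.
    by apply: ler_prod => j _; rewrite r0 retq.
  rewrite (_ : _ * A = 2 * (c * A) * q ^+ k); last by ring.
  by rewrite cA mulrC; lra.
apply: le_trans (lightp_decay _ V0 mm k _ mm0 th0 thM Qsum n) _.
rewrite expRD ler_wpM2r ?expR_ge0 //.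
apply: le_trans (expR_le1Dx2 _ _ thM) _; first by rewrite mulr_ge0.
by lra.
Qed.

End LightDecay.

Theorem mainTheorem2 (R : realType) (disp : measure_display)
    (Omega : measurableType disp) (P : probability Omega R)
    (d : nat) (hd : (3 <= d)%N) (S : nat -> Omega -> 'rV[int]_d)
    (hS : simple_random_walk P S) :
  exists n0 : R -> {RV P >-> nat},
    {ae P, forall w : Omega, forall eps : R, 0 < eps ->
      forall n : nat, (n0 eps w <= n)%N ->
        walk_lambda P S * ln n%:R - (2 + eps) * ln (ln n%:R)
          <= max_local_time R S n w}.
Proof.
pose q := 1 - escape_prob P S.
have lamE : walk_lambda P S = - 1 / ln q by [].
have asRV (f : Omega -> nat) : (forall B, measurable (f @^-1` B)) ->
    exists F : {RV P >-> nat}, forall w, F w = f w.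
  move=> mf; have mF : measurable_fun setT f by move=> _ B _; rewrite setTI; exact: mf.
  pose F : {RV P >-> nat} := HB.pack f (isMeasurableFun.Build _ _ _ _ f mF).
  by exists F.
have [q01|nq01] := boolP (0 < q < 1); last first.
  (* Here [ln q = 0], also for [q <= 0] by the junk value of [ln], and then
     [walk_lambda] is [-1 / 0 = 0]. *)
  have ln_q : ln q = 0.
    have [q0|q0] := leP q 0; first exact: ln0.
    rewrite q0 /= -leNgt in nq01.
    rewrite (_ : q = 1) ?ln1 //; apply/le_anti; rewrite nq01 andbT.
    by rewrite gerBl escape_prob_ge0.
  (* Beyond [e], [ln (ln n)] is nonnegative and the left-hand side is at most 0. A constant is
     decided by the empty trajectory. *)
  have [F FE] := asRV (fun=> (Num.truncn (expR 1 : R)).+1)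
    (fun B => measurable_trajectory hS 0 (fun=> _)).
  exists (fun=> F); apply: aeW => w eps eps0 n; rewrite FE => nn.
  rewrite lamE ln_q invr0 mulr0 mul0r sub0r.
  have [_ /(_ 0)] := max_local_time_max R S n w; apply: le_trans.
  apply: le_trans (ler0n _ _); rewrite oppr_le0 mulr_ge0 ?addr_ge0 ?(ltW eps0) //.
  apply: ln_ge0; rewrite -[leLHS]expRK ler_ln ?posrE ?expR_gt0 ?ltr0n //; last by case: n nn.
  by apply: le_trans (ltW (truncnS_gt _)) _; rewrite ler_nat.
have retq m : retp (@srw_step d) m <= q.
  by have := escape_prob_le hd hS m; rewrite /q; lra.
have qret m : (0 < m)%N -> q <= retp (@srw_step d) m + ret_tail (d := d) m.
  by move=> m0; have := escape_prob_bounds hd hS m m0; rewrite /q; lra.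
have [c [c0 decay]] := lightp_exp_decay hd q q01 retq qret.
have [K1 logK1] := level_time_log q c q01 c0.
have /andP[q0 q1] := q01.
pose A k := all_light (S := S) k (level_time q c k).
have mA k : measurable (A k) by exact: (measurable_all_light hS).
have PA k : (P (A k) <= (2 / k.+1%:R ^+ 2)%:E)%E.
  rewrite P_all_light // lee_fin; apply: le_trans (decay _ _) _.
  rewrite ler_wpM2l // -[leRHS]lnK ?posrE ?invr_gt0 ?exprn_gt0 //.
  rewrite ler_expR lnV ?posrE ?exprn_gt0 // lerN2 lnXn // -[ln _ *+ 2]mulr_natl.
  have := ltW (@level_time_gt R q c k); rewrite ler_pdivrMr ?mulr_gt0 ?exprn_gt0 //.
  by rewrite [X in _ <= X]mulrC.
have sumA : (\sum_(0 <= k <oo) P (A k) < +oo)%E.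
  apply: le_lt_trans (ltry (4 : R)); apply: lime_le; first exact: is_cvg_ereal_nneg_natsum.
  exists 0%N => // n _ /=.
  apply: le_trans (_ : (\sum_(0 <= k < n) (2 / k.+1%:R ^+ 2)%:E <= _)%E).
    by apply: lee_sum => k _.
  rewrite sumEFin lee_fin big_mkord.
  (* Telescoping bound, from [2 / y^2 <= 4 / (y (y+1))] for [y >= 1]. *)
  suff : \sum_(k < n) (2 / k.+1%:R ^+ 2) <= 4 - 4 / n.+1%:R :> R.
    by move=> /le_trans; apply; rewrite gerBl divr_ge0.
  elim: n => [|n IHn]; first by rewrite big_ord0 divr1 subrr.
  rewrite big_ord_recr /=; apply: le_trans (lerD IHn (lexx _)) _.
  rewrite -[n.+2%:R]natr1.
  have : 1 <= n.+1%:R :> R by rewrite ler1n.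
  move: (n.+1%:R : R) => y y1.
  have y0 : 0 < y by exact: lt_le_trans y1.
  suff : 2 / y ^+ 2 <= 4 / y - 4 / (y + 1).
    by rewrite -addrA lerD2l; move: (2 / _) (4 / y) (4 / (y + 1)) => *; lra.
  rewrite [leRHS](_ : _ = 4 / (y * (y + 1))); last first.
    by field; rewrite !gt_eqF // addr_gt0.
  rewrite ler_pdivrMr ?exprn_gt0 // mulrAC ler_pdivlMr ?mulr_gt0 ?addr_gt0 //.
  by rewrite expr2; nra.
(* Borel-Cantelli: almost surely only finitely many [A k] occur. *)
have limA : P (lim_sup_set A) = 0%E by apply: lim_sup_set_cvg0.
pose D n := \bigcap_(k in [set k | (n <= k)%N]) ~` A k.
have mD n : measurable (D n).
  by apply: bigcap_measurable => [|k _]; [exists n => /= | exact: measurableC].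
(* [K0] is a measurable index from which on no [A k] occurs, wherever such an index exists. *)
have [K0 [mK0 DK0]] := exists_measurable_first D mD.
have [F FE] := asRV (fun w => level_time q c (maxn (K0 w) K1))
  (fun B => mK0 (fun k => B (level_time q c (maxn k K1)))).
(* One threshold serves every [eps]: it makes [ln (ln n)] nonnegative, so raising the coefficient
   from 2 to [2 + eps] only lowers the bound. *)
exists (fun=> F); exists (lim_sup_set A); split => //.
  apply: bigcap_measurable => // n _; apply: bigcup_measurable => k _; exact: mA.
move=> w /=; apply: contra_notP => nlim eps eps0 n; rewrite FE => nn.
have {}DK0 : D (K0 w) w.
  apply: DK0; apply: contra_notP nlim => nD n' _.
  apply: contrapT => nA; apply: nD; exists n' => k /= kn Ak.
  by apply: nA; exists k.
have [k [Kk kn nk]] := level_time_bracket q c q01 c0 _ _ nn.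
move: Kk; rewrite geq_max => /andP[K0k K1k].
have [lnln0 hk] := logK1 k n K1k kn nk.
have : ~ A k w by exact: DK0.
move=> /existsNP[x /negP]; rewrite -leqNgt => kx.
have [_ /(_ x)] := max_local_time_max R S n w; apply: le_trans.
(* The [k] visits to [x] are complete at the level time, and its local time only grows up to [n]. *)
apply: le_trans (_ : k%:R <= _); last first.
  rewrite ler_nat (leq_trans kx) // /local_time.
  rewrite [leqRHS](@big_cat_nat _ _ _ (level_time q c k).+1) //=.
  exact: leq_addr.
rewrite lamE; apply: le_trans hk; rewrite lerD2l lerN2 ler_wpM2r //.
by rewrite lerDl ltW.
Qed.
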